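(* Let $q\ge2$ be an integer, let $\{X_n\}_{n\ge1}$ be a stationary stochastic process with state space $\{0,\ldots,q-1\}$, and let $F$ be the cumulative distribution function of $X=\sum_{n=1}^\infty X_nq^{-n}$. Let $x=(0.x_1x_2\ldots)_q\in[0,1]$. Then $F$ is continuous at $x$ if and only if $\lim_{n\to\infty}p(x_1,\ldots,x_n)=0$.
   Context: Stationary means that $\{X_n\}_{n\ge1}$ and $\{X_n\}_{n\ge2}$ are identically distributed. $F(x)=\mathrm P(X\le x)$ for $x\in\mathbb R$. For digits $x_n\in\{0,\ldots,q-1\}$, $(0.x_1x_2\ldots)_q=\sum_{n=1}^\infty x_nq^{-n}$, and $p(x_1,\ldots,x_n)=\mathrm P(X_1=x_1,\ldots,X_n=x_n)$. *)

(* Defs.v *)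
From HB Require Import structures.
From mathcomp Require Import all_boot all_order all_algebra.
From mathcomp Require Import all_classical all_reals all_analysis.
From mathcomp Require Import measurable_realfun.
Import Order.TTheory GRing.Theory Num.Theory.
Import numFieldNormedType.Exports.

Set Implicit Arguments.
Unset Strict Implicit.
Unset Printing Implicit Defensive.

Local Open Scope classical_set_scope.
Local Open Scope ring_scope.

(* Sequences are indexed from 0: the term of index n is the (n+1)-st digit
   x_(n+1) of the 1-indexed sequence (x_1, x_2, ...). *)

(* (0.x_1 x_2 ...)_q *)
Definition base_value (R : realType) (q : nat) (x : nat -> nat) : R :=
  limn (series (fun n => (x n)%:R / q%:R ^+ n.+1 : R)).

(* The product (cylinder) sigma-algebra on E^nat. *)
Definition path_measurable d (E : measurableType d) : set (set (nat -> E)) :=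
  <<s \bigcup_(n in [set: nat])
        preimage_set_system [set: nat -> E] (fun u => u n) measurable >>.

Section Process.
Context d (T : measurableType d) (R : realType) (P : probability T R).

Definition identically_distributed d' (E : measurableType d')
    (X Y : nat -> {RV P >-> E}) : Prop :=
  forall A : set (nat -> E), path_measurable A ->
    P [set w | A (fun n => X n w)] = P [set w | A (fun n => Y n w)].

Definition stationary d' (E : measurableType d') (X : nat -> {RV P >-> E}) :=
  identically_distributed X (fun n => X n.+1).

(* p(x_1, ..., x_n) *)
Definition word_probability (X : nat -> {RV P >-> nat}) (x : nat -> nat)
    (n : nat) : \bar R :=
  P [set w | forall i, (i < n)%N -> X i w = x i].

(* The random variable X_1 / q + X_2 / q ^ 2 + ... *)
Definition base_rv (q : nat) (X : nat -> {RV P >-> nat}) (w : T) : R :=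
  base_value R q (fun n => X n w).

(* No bound on the digits is assumed here: where the series diverges, the
   partial sums tend to +oo and the limit operator of R returns 0. *)
Let base_rvE q X w : base_rv q X w =
  fine (\sum_(0 <= n <oo) ((X n w)%:R / q%:R ^+ n.+1 : R)%:E)%E.
Proof.
rewrite /base_rv /base_value /series /=.
set u := fun n => ((X n w)%:R / q%:R ^+ n.+1 : R).
have u0 n : 0 <= u n by rewrite divr_ge0// exprn_ge0.
have undec : nondecreasing_seq (fun n => \sum_(0 <= k < n) u k).
  by apply: nondecreasing_series.
rewrite (_ : (fun n => _)%E = EFin \o (fun n => \sum_(0 <= k < n) u k));
  last by apply/funext => n; rewrite /= sumEFin.
case: (pselect (cvgn (fun n => \sum_(0 <= k < n) u k))) => [cu|ncu].
  by rewrite EFin_lim.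
rewrite dvgP//.
have /cvgeryP/cvg_lim -> // : (fun n => \sum_(0 <= k < n) u k) @ \oo --> +oo.
exact: nondecreasing_dvgn_lt.
Qed.

Let measurable_base_rv q X : measurable_fun [set: T] (base_rv q X).
Proof.
pose h n w : \bar R := ((X n w)%:R / q%:R ^+ n.+1 : R)%:E.
rewrite (_ : base_rv q X = fine \o (fun w => \sum_(0 <= n <oo) h n w)%E);
  last by apply/funext => w; rewrite base_rvE.
apply: (measurableT_comp (fine_measurable measurableT)).
apply: (@ge0_emeasurable_sum _ _ _ setT h xpredT).
  by move=> n w _ _; rewrite lee_fin divr_ge0// exprn_ge0.
move=> n _; apply/measurable_EFinP.
have mg : measurable_fun [set: nat] (fun k : nat => k%:R / q%:R ^+ n.+1 : R).
  by [].
exact: (measurableT_comp mg (measurable_funPT (X n))).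
Qed.

HB.instance Definition _ q X := isMeasurableFun.Build d _ T R
  (base_rv q X) (measurable_base_rv q X).

End Process.

(* Main.v *)
(* F jumps at x by P(X = x).  If two different digit sequences have the same
   value, then one of them ends in zeros only and the other in digits q - 1
   only, and neither of them is constant from the index where they first differ.
   For every k and c, stationarity gives P(X_n = c for n >= k) =
   P(X_n = c for n > k), so the event that X_k <> c and X_n = c for all n > k is
   null.  Hence P(X = x) = P(X_n = x_n for all n), which is the limit of
   p(x_1,...,x_n). *)

Require Import Defs.
From HB Require Import structures.
From mathcomp Require Import all_boot all_order all_algebra.
From mathcomp Require Import all_classical all_reals all_analysis.
From mathcomp Require Import ring lra zify.
Import Order.TTheory GRing.Theory Num.Theory.
Import numFieldNormedType.Exports.

Local Open Scope classical_set_scope.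
Local Open Scope ring_scope.

(** * Continuity points of a cumulative distribution function *)

Section Cdf.
Context d (T : measurableType d) (R : realType) (P : probability T R).
Variable Y : {RV P >-> R}.

(** Monotonicity and the bound 1 make the left limit exist, so it can be computed along the single
    sequence x - 1/(n+1). There the events increase to Y < x, and continuity of P from below gives
    the value. *)
Lemma cdf_cvg_at_left (x : R) :
  cdf Y y @[y --> x^'-] --> P (Y @^-1` `]-oo, x[).
Proof.
have fineF y : (fine (cdf Y y))%:E = cdf Y y by rewrite fineK// fin_num_measure.
have cvF : cvg (fine (cdf Y y) @[y --> x^'-]).
  apply: nondecreasing_at_left_is_cvgr.
    apply: nearW => y a b _ _ ab.
    by rewrite fine_le ?fin_num_measure// cdf_nondecreasing.
  apply: nearW => y; exists 1 => _ [z _ <-].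
  by rewrite -lee_fin fineF cdf_le1.
have {cvF}[l Fl] := (cvg_ex _).1 cvF.
have {}Fl : cdf Y y @[y --> x^'-] --> l%:E.
  under eq_fun do rewrite -fineF.
  by apply/cvg_EFin => //; apply: nearW.
suff <- : l%:E = P (Y @^-1` `]-oo, x[) by [].
have Fu : cdf Y (x - n.+1%:R^-1) @[n --> \oo] --> l%:E.
  move/cvge_at_leftP : Fl; apply; split=> [n|]; first by rewrite ltrBlDr ltrDl.
  rewrite -[X in _ --> X]subr0; apply: (@cvgB _ R^o); first exact: cvg_cst.
  exact: cvg_harmonic.
have Fu' : cdf Y (x - n.+1%:R^-1) @[n --> \oo] --> P (Y @^-1` `]-oo, x[).
  have -> : `]-oo, x[%classic = \bigcup_n `]-oo, x - n.+1%:R^-1]%classic.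
    apply/seteqP; split=> y /=; rewrite in_itv/=.
      move=> /ltr_add_invr[n yx]; exists n => //=.
      by rewrite in_itv/= lerBrDr ltW.
    move=> [n _]/=; rewrite in_itv/= => /le_lt_trans; apply.
    by rewrite ltrBlDr ltrDl.
  rewrite preimage_bigcup.
  apply: (@nondecreasing_cvg_mu _ _ _ P
    (fun n => Y @^-1` `]-oo, x - n.+1%:R^-1]%classic)) => [n||m n mn].
  - exact: measurable_funPTI.
  - by apply: bigcup_measurable => n _; exact: measurable_funPTI.
  - apply/subsetPset; apply: preimage_subset; apply: subset_itvl.
    by rewrite bnd_simp lerD2l lerN2 lef_pV2 ?posrE// ler_nat.
exact: (cvg_unique _ Fu Fu').
Qed.

(** Right continuity is automatic, so only the left limit P(Y < x) must be compared with P(Y <= x).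
    They differ by the mass of the point x. *)
Lemma continuous_cdfP (x : R) :
  {for x, continuous (cdf Y)} <-> P (Y @^-1` [set x]) = 0%E.
Proof.
have -> : {for x, continuous (cdf Y)} <-> P (Y @^-1` `]-oo, x[) = cdf Y x.
  rewrite /continuous_at; split=> [/left_right_continuousP[Fl _]|Fx].
    exact: (cvg_unique _ (cdf_cvg_at_left x) Fl).
  apply/left_right_continuousP; split; last exact: cdf_right_continuous.
  by rewrite -Fx; exact: cdf_cvg_at_left.
have -> : cdf Y x = (P (Y @^-1` `]-oo, x[) + P (Y @^-1` [set x]))%E.
  rewrite -measureU//; last 2 first.
    exact: measurable_funPTI.
    by apply/seteqP; split=> w //= [] /[swap] ->; rewrite in_itv/= ltxx.
  by rewrite -preimage_setU setUitv1.
have f1 : P (Y @^-1` `]-oo, x[) \is a fin_num.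
  by apply: fin_num_measure; exact: measurable_funPTI.
split=> [e|->]; last by rewrite adde0.
by rewrite -[LHS](addeK _ f1) [X in (X - _)%E]addeC -e subee.
Qed.
End Cdf.

(** * Values of base-q expansions and their ambiguity *)

Section Digits.
Context (R : realType) (q : nat) (hq : (2 <= q)%N).
Implicit Types x y : nat -> nat.
Notation bv := (base_value R q).

Let u x n : R := (x n)%:R / q%:R ^+ n.+1.

Let q0 : (0 : R) < q%:R. Proof. by rewrite ltr0n; lia. Qed.

Let qn0 : (q%:R : R) != 0. Proof. by rewrite gt_eqF. Qed.

(** The bound is the partial sum obtained when every digit equals q - 1. *)
Let sum_le x n : (forall n, (x n < q)%N) -> series (u x) n <= 1 - q%:R ^- n.
Proof.
move=> xq; elim: n => [|n IH].
  by rewrite seriesEnat/= big_geq// invr1 subrr.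
rewrite seriesSr (le_trans (lerD IH (lexx _)))// /u.
(* Over the common denominator q^(n+1), the induction step reduces to x_n + 1 <= q. *)
have -> : (q%:R ^- n : R) = q%:R / q%:R ^+ n.+1.
  by rewrite exprS; field; rewrite expf_neq0//=.
rewrite -addrA lerD2l -mulNr -mulrDl -[leRHS]mulN1r.
rewrite ler_pM2r ?invr_gt0 ?exprn_gt0//.
have : ((x n).+1%:R : R) <= q%:R by rewrite ler_nat.
rewrite -natr1; lra.
Qed.

Let u_ge0 x n : 0 <= u x n.
Proof. by rewrite /u divr_ge0// exprn_ge0. Qed.

Lemma is_cvg_base_series x : (forall n, (x n < q)%N) -> cvgn (series (u x)).
Proof.
move=> xq; apply: nondecreasing_is_cvgn.
  by apply: nondecreasing_series => n _ _; exact: u_ge0.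
by exists 1 => _ [n _ <-]; rewrite (le_trans (sum_le _ n xq)).
Qed.

Lemma base_value_ge0 x : (forall n, (x n < q)%N) -> 0 <= bv x.
Proof.
move=> xq; apply: limr_ge; first exact: is_cvg_base_series.
by apply: nearW => n; apply: sumr_ge0 => i _; exact: u_ge0.
Qed.

Lemma base_value_le1 x : (forall n, (x n < q)%N) -> bv x <= 1.
Proof.
move=> xq; apply: limr_le; first exact: is_cvg_base_series.
by apply: nearW => n; rewrite (le_trans (sum_le _ n xq)).
Qed.

(** Multiplying by q moves the first digit in front of the point. All inductions on digits below
    peel off one digit this way. *)
Lemma base_valueS x : (forall n, (x n < q)%N) ->
  q%:R * bv x = (x 0%N)%:R + bv (fun n => x n.+1).
Proof.
move=> xq; set y := fun n => x n.+1.
have cx := is_cvg_base_series _ xq.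
have cy := is_cvg_base_series y (fun n => xq _).
have E n : q%:R * series (u x) n.+1 = (x 0%N)%:R + series (u y) n.
  rewrite !seriesEnat/= big_nat_recl//= mulrDr /u expr1.
  rewrite mulrCA divff ?mulr1; last exact: qn0.
  congr (_ + _); rewrite mulr_sumr; apply: eq_bigr => i _.
  by rewrite (exprS _ i.+1) /y; field; rewrite expf_neq0.
have h1 : q%:R * series (u x) n.+1 @[n --> \oo] --> q%:R * bv x.
  by apply: cvgMl_tmp; rewrite (cvg_shiftS (series (u x))); exact: cx.
have h2 : q%:R * series (u x) n.+1 @[n --> \oo] --> (x 0%N)%:R + bv y.
  under eq_fun do rewrite E.
  by apply: cvgD; [exact: cvg_cst|exact: cy].
exact: (cvg_unique _ h1 h2).
Qed.

Lemma base_value_eq0 x : (forall n, (x n < q)%N) -> bv x = 0 ->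
  forall n, x n = 0%N.
Proof.
move=> xq x0 n; elim: n x xq x0 => [|n IH] x xq x0.
  have := base_valueS _ xq.
  have := base_value_ge0 (fun n => x n.+1) (fun n => xq _).
  rewrite x0 => h1 h2; apply/eqP; rewrite -(eqr_nat R); apply/eqP.
  have : (0 : R) <= (x 0%N)%:R by []. lra.
apply: (IH (fun n => x n.+1)) => //.
have := base_valueS _ xq.
have := base_value_ge0 (fun n => x n.+1) (fun n => xq _).
have : (0 : R) <= (x 0%N)%:R by [].
rewrite x0; lra.
Qed.

(** In q = y_0 + (value of the tail), the digit is at most q - 1 and the tail at most 1, so both
    bounds are attained and the tail again has value 1. *)
Lemma base_value_eq1 x : (forall n, (x n < q)%N) -> bv x = 1 ->
  forall n, x n = q.-1.
Proof.
have S y : (forall n, (y n < q)%N) -> bv y = 1 ->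
    y 0%N = q.-1 /\ bv (fun n => y n.+1) = 1.
  move=> yq y1.
  have := base_valueS _ yq.
  have := base_value_le1 (fun n => y n.+1) (fun n => yq _).
  have : ((y 0%N).+1%:R : R) <= q%:R by rewrite ler_nat.
  rewrite -natr1 y1 => h1 h2 h3; split; last lra.
  suff : (y 0%N).+1 = q by lia.
  apply/eqP; rewrite -(eqr_nat R) -natr1; apply/eqP; lra.
move=> xq x1 n; elim: n x xq x1 => [|n IH] x xq x1.
  by have [] := S _ xq x1.
by apply: (IH (fun n => x n.+1)) => //; have [] := S _ xq x1.
Qed.

(** After multiplication by q the integer parts differ by at least 1 while both tails lie in [0, 1].
    Hence the tail of x has value 1 and that of y has value 0. *)
Lemma base_value_eq_lt x y :
  (forall n, (x n < q)%N) -> (forall n, (y n < q)%N) ->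
  bv x = bv y -> (x 0%N < y 0%N)%N ->
  (forall n, x n.+1 = q.-1) /\ (forall n, y n.+1 = 0%N).
Proof.
move=> xq yq xy lt0.
have := base_value_le1 (fun n => x n.+1) (fun n => xq _).
have := base_value_ge0 (fun n => y n.+1) (fun n => yq _).
have := base_valueS _ xq; rewrite xy base_valueS// => e h1 h2.
have : ((x 0%N).+1%:R : R) <= (y 0%N)%:R by rewrite ler_nat.
rewrite -natr1 => h3.
by split; [apply: (base_value_eq1 (fun n => x n.+1))
          |apply: (base_value_eq0 (fun n => y n.+1))] => //; lra.
Qed.

(** Equal leading digits are stripped until the heads differ. The conclusion mentions x alone, so
    that the exceptional paths are covered by countably many events, one for each pair (c, k). *)
Lemma base_value_eq_tail x y :
  (forall n, (x n < q)%N) -> (forall n, (y n < q)%N) ->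
  bv x = bv y -> ~ (forall n, x n = y n) ->
  exists c k, x k <> c /\ forall n, (k < n)%N -> x n = c.
Proof.
have head a b : (forall n, (a n < q)%N) -> (forall n, (b n < q)%N) ->
    bv a = bv b -> a 0%N <> b 0%N ->
    exists c k, a k <> c /\ forall n, (k < n)%N -> a n = c.
  move=> aq bq ab /eqP; rewrite neq_ltn => /orP[] lt0.
    have [h _] := base_value_eq_lt _ _ aq bq ab lt0.
    (* Here a_0 < b_0 <= q - 1, so a_0 is not q - 1; in the other case a_0 > b_0 >= 0, so a_0 is not
       0. *)
    exists q.-1, 0%N; split; first by have := bq 0%N; lia.
    by case.
  have [_ h] := base_value_eq_lt _ _ bq aq (esym ab) lt0.
  exists 0%N, 0%N; split; first lia.
  by case.
move=> xq yq xy /existsNP[k]; elim: k x y xq yq xy => [|k IH] x y xq yq xy nk.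
  exact: (head x y).
have [e0|/eqP] := eqVneq (x 0%N) (y 0%N); last exact: (head x y).
have [||||c [j [h1 h2]]] := IH (fun n => x n.+1) (fun n => y n.+1) => //.
  have := base_valueS _ xq; rewrite xy base_valueS// e0; lra.
by exists c, j.+1; split=> // -[//|n]; exact: h2.
Qed.
End Digits.

(** * Stationarity and the atoms of the random expansion *)

Section Process.
Context d (T : measurableType d) (R : realType) (P : probability T R).
Variable X : nat -> {RV P >-> nat}.

Let measurable_digit n (A : set nat) : measurable (X n @^-1` A).
Proof. exact: measurable_funPTI. Qed.

(** Stationarity can be applied only to sets in the cylinder sigma-algebra; this admits the tail
    sets. *)
Lemma path_measurable_tail (c k : nat) :
  path_measurable [set u : nat -> nat | forall i, u (k + i)%N = c].
Proof.
have -> : [set u : nat -> nat | forall i, u (k + i)%N = c] =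
    \bigcap_i (fun u => u (k + i)%N) @^-1` [set c].
  by apply/seteqP; split=> [u uc i _|u uc i]; [exact: uc|exact: (uc i)].
pose G := \bigcup_(n in [set: nat])
  preimage_set_system [set: nat -> nat] (fun u => u n) measurable.
apply: (@bigcap_measurable _ (g_sigma_algebraType G)) => // i _.
apply: sub_sigma_algebra; exists (k + i)%N => //.
by exists [set c] => //; rewrite setTI.
Qed.

(** The event is the difference of the nested events [A k.+1] and [A k], which have the same finite
    probability by stationarity. *)
Lemma stationary_tail_negligible (c k : nat) : stationary X ->
  P.-negligible [set w | X k w <> c /\ forall n, (k < n)%N -> X n w = c].
Proof.
move=> hX; pose A m := [set w | forall i, X (m + i) w = c].
have mA m : measurable (A m).
  rewrite (_ : A m = \bigcap_i (X (m + i) @^-1` [set c])).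
    by apply: bigcap_measurable => // i _; exact: measurable_digit.
  by apply/seteqP; split=> [u uc i _|u uc i]; [exact: uc|exact: (uc i)].
have AS : A k `<=` A k.+1 by move=> w Aw i; rewrite addSnnS; exact: Aw.
have -> : [set w | X k w <> c /\ forall n, (k < n)%N -> X n w = c] =
    A k.+1 `\` A k.
  apply/seteqP; split=> w /= [h1 h2].
    split=> [i|]; first by apply: h2; lia.
    by move=> /(_ 0%N); rewrite addn0.
  split=> [kc|n kn]; last by rewrite -(h1 (n - k.+1)%N); congr (X _ _); lia.
  apply: h2 => -[|i]; first by rewrite addn0.
  by rewrite addnS -addSn; exact: h1.
apply/negligibleP; first exact: measurableD.
rewrite measureD//; last by rewrite -ge0_fin_numE// fin_num_measure.
(* Shifting the process turns the index k + i into (k + i) + 1, which is [k.+1 + i] by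
   computation. *)
have PA : P (A k) = P (A k.+1) := hX _ (path_measurable_tail c k).
by rewrite setIidr// -[X in (_ - X)%E]/(P (A k)) PA subee// fin_num_measure.
Qed.

(** Continuity of P from above, along the decreasing events of agreement in the first n digits. *)
Lemma cvg_word_probability (x : nat -> nat) :
  word_probability X x n @[n --> \oo] --> P [set w | forall n, X n w = x n].
Proof.
have mB (i : nat) (n : nat) : measurable [set w | (i < n)%N -> X i w = x i].
  have [lt|ge] := ltnP i n.
    rewrite (_ : [set w | _] = X i @^-1` [set x i]).
      exact: measurable_digit.
    by apply/seteqP; split=> w /= h; [exact: h|move=> _].
  rewrite (_ : [set w | _] = setT); first exact: measurableT.
  by apply/seteqP; split.
pose F n := [set w | forall i, (i < n)%N -> X i w = x i].
have mF n : measurable (F n).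
  rewrite (_ : F n = \bigcap_i [set w | (i < n)%N -> X i w = x i]).
    by apply: bigcap_measurable.
  by apply/seteqP; split=> [u uc i _|u uc i]; [exact: uc|exact: (uc i)].
have -> : [set w | forall n, X n w = x n] = \bigcap_n F n.
  apply/seteqP; split=> [w h n _ i _|w h n]; first exact: h.
  exact: (h n.+1 I n).
apply: (@nonincreasing_cvg_mu _ _ _ _ F) => //.
- by rewrite -ge0_fin_numE// fin_num_measure.
- exact: bigcap_measurable.
- by move=> m n mn; apply/subsetPset => w h i im; apply: h; lia.
Qed.

Lemma base_rv_atom (q : nat) (x : nat -> nat) : (2 <= q)%N ->
  (forall n w, (X n w < q)%N) -> (forall n, (x n < q)%N) -> stationary X ->
  P (base_rv q X @^-1` [set base_value R q x]) =
  P [set w | forall n, X n w = x n].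
Proof.
move=> hq hX hx hs.
set A := [set w | _]; set B := _ @^-1` _.
have AB : A `<=` B.
  by move=> w Aw; rewrite /B/= /base_rv; congr base_value; apply/funext.
have mA : measurable A.
  rewrite (_ : A = \bigcap_n X n @^-1` [set x n]).
    by apply: bigcap_measurable => // n _; exact: measurable_digit.
  by apply/seteqP; split=> [u uc i _|u uc i]; [exact: uc|exact: (uc i)].
have mB : measurable B by exact: measurable_funPTI.
have : P.-negligible (B `\` A).
  pose N c k := [set w | X k w <> c /\ forall n, (k < n)%N -> X n w = c].
  (* A path with the same value as x but different from x is eventually constant, with a last index
     k at which it is not c. *)
  apply: (@negligibleS _ _ _ _ (\bigcup_c \bigcup_k N c k)).
    move=> w [Bw nAw].
    have [|c [k Nck]] :=
      base_value_eq_tail R q hq (fun n => X n w) x _ hx Bw nAw => //.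
    by exists c => //; exists k.
  apply: negligible_bigcup => c; apply: negligible_bigcup => k.
  exact: stationary_tail_negligible.
move/negligibleP => /(_ (measurableD mB mA)) BA0.
rewrite -(setDUK AB) measureU//; [|exact: measurableD|].
  by rewrite BA0 adde0.
by rewrite setIDA setIC -setIDA setDv setI0.
Qed.
End Process.

Theorem proposition2p2 (R : realType) (d : measure_display)
    (T : measurableType d) (P : probability T R)
    (q : nat) (hq : (2 <= q)%N)
    (X : nat -> {RV P >-> nat})
    (hX : forall (n : nat) (w : T), (X n w < q)%N)
    (hstat : stationary X)
    (x : R) (hx01 : 0 <= x <= 1)
    (xs : nat -> nat) (hxs : forall n : nat, (xs n < q)%N)
    (hx : x = base_value R q xs) :
  {for x, continuous (cdf (base_rv q X : {RV P >-> R}))} <->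
  word_probability X xs n @[n --> \oo] --> 0%E.
Proof.
rewrite continuous_cdfP hx base_rv_atom//.
have cw := cvg_word_probability _ _ _ _ X xs.
(* The word probabilities always converge to the mass of the atom, so they tend to 0 exactly when
   that mass is 0. *)
split=> [<- //|w0]; exact: (cvg_unique _ cw w0).
Qed.
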